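(* Let $r$ be a Hermitian symmetric polynomial in one complex variable $z$ with $r(z,\overline z)\ge 0$ for all $z\in\mathbb{C}$. The following are equivalent: (1) There is a holomorphic polynomial $h$ and a Hermitian symmetric polynomial $R$ such that $r=|h|^2R$, $R(z,\overline z)>0$ for all $z\in\mathbb{C}$, and the total degree of $R$ is twice the degree of $R$ in $z$. (2) There is a holomorphic polynomial $h$ such that $r=|h|^2R$ with $R\in\mathcal{Q}(1)$. (3) $r\in\mathcal{Q}(1)$. (4) There is a holomorphic polynomial $h$ such that $r=|h|^2R$ with $R\in\mathcal{Q}'(1)$. (5) $r\in\mathcal{Q}'(1)$.
   Context: A Hermitian symmetric polynomial in $n$ variables is a polynomial $r(z,\overline{w})=\sum c_{\alpha\beta}z^\alpha\overline w^\beta$ with $c_{\alpha\beta}=\overline{c_{\beta\alpha}}$. Its degree in $z$ is the largest $|\alpha|$ with some $c_{\alpha\beta}\neq 0$, and its total degree is the largest $|\alpha|+|\beta|$ with $c_{\alpha\beta}\ne 0$ (treating $z$ and $\overline z$ as independent variables). For a holomorphic polynomial mapping $F=(F_1,\dots,F_N)$, $\|F\|^2=\sum|F_j|^2$. $\mathcal{Q}(n)$: Hermitian symmetric polynomials $r$ with $r=\|F\|^2/\|G\|^2$ for holomorphic polynomial mappings $F,G$, $G\not\equiv 0$. $\mathcal{Q}'(n)$: Hermitian symmetric polynomials $r$ with $r(z,\overline z)\ge0$ for all $z$ such that there exist a Hermitian symmetric polynomial $s\ge 0$, not identically $0$, and a holomorphic polynomial mapping $F$ with $rs=\|F\|^2$.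 *)

(* Defs.v *)
From HB Require Import structures.
From mathcomp Require Import all_boot all_order all_algebra.
From mathcomp Require Import complex.
From mathcomp Require Import reals.
Set Implicit Arguments. Unset Strict Implicit. Unset Printing Implicit Defensive.
Import Order.TTheory GRing.Theory Num.Theory.
Local Open Scope ring_scope.

(* A polynomial r(z, wbar) = sum c_{ab} z^a wbar^b in one variable z is
   represented by p : {poly {poly C}} with c_{ab} = (p`_a)`_b :
   the outer variable carries z, the inner one carries wbar. *)
Section Herm.
Variable C : numClosedFieldType.

Definition hcoef (p : {poly {poly C}}) (a b : nat) : C := (p`_a)`_b.

Definition hermsym (p : {poly {poly C}}) : Prop :=
  forall a b : nat, hcoef p a b = (hcoef p b a)^*.

Definition hval (p : {poly {poly C}}) (z : C) : C :=
  (map_poly (fun q : {poly C} => q.[z^*]) p).[z].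

Definition degz (p : {poly {poly C}}) : nat := (size p).-1.

Definition totdeg (p : {poly {poly C}}) : nat :=
  \max_(a < size p | (p`_a != 0)%R) (a + (size (p`_a)%R).-1)%N.

(* |h|^2 = h(z) conj(h(w)), coefficients c_{ab} = h_a conj(h_b) *)
Definition hsq (h : {poly C}) : {poly {poly C}} :=
  \poly_(a < size h) (h`_a *: map_poly (@Num.conj_op C) h).

Definition normsq (F : seq {poly C}) : {poly {poly C}} :=
  \sum_(f <- F) hsq f.

(* Q(1): r = ||F||^2/||G||^2, G not identically 0 (identity of rational
   functions, i.e. r ||G||^2 = ||F||^2) *)
Definition inQ (r : {poly {poly C}}) : Prop :=
  hermsym r /\
  exists F G : seq {poly C}, has (fun g => g != 0) G /\ r * normsq G = normsq F.

Definition inQ' (r : {poly {poly C}}) : Prop :=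
  hermsym r /\ (forall z : C, 0 <= hval r z) /\
  exists (s : {poly {poly C}}) (F : seq {poly C}),
    [/\ hermsym s, (forall z : C, 0 <= hval s z), s != 0 & r * s = normsq F].
End Herm.

(* Main.v *)
(** Sufficiency of positivity.  Let p > 0 have bidegree (m, m) with c_mm <> 0.  The
   functions u_j = |1|^2, |z|^2, |1 + z|^2, |1 - i z|^2 are barycentric
   coordinates on the space of Hermitian 2 x 2 matrices [[A, B], [B', D]], and p
   is a real form f of degree m in them.  On the simplex of nonnegative
   coordinates, the rank one matrices, where f > 0, are the zeros of
   g = A D - |B|^2; hence f S^4 + kappa g^2 S^m is positive on the simplex for
   large kappa, S being the sum of the coordinates.  By Polya's theorem a power
   of S turns it into a form with nonnegative coefficients, and substituting the
   u_j, at which g vanishes, writes p S^N as a squared norm; S is itself a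
   squared norm.

   Necessity.  If r s = ||F||^2 and r vanishes at a, then so does F, hence
   z - a divides r or s, and by symmetry |z - a|^2 does; dividing repeatedly
   leaves a factor without zeros.  The top diagonal coefficient of ||F||^2 is
   nonzero, which gives the condition on the degrees. *)
Require Import Defs.
From HB Require Import structures.
From mathcomp Require Import all_boot all_order all_algebra.
From mathcomp Require Import polyXY ring lra zify.
From mathcomp Require Import complex.
From mathcomp Require Import boolp classical_sets reals topology normedtype derive.
Import numFieldNormedType.Exports.
Import Order.TTheory GRing.Theory Num.Theory.
Local Open Scope ring_scope.
Set Implicit Arguments. Unset Strict Implicit. Unset Printing Implicit Defensive.

(** * Hermitian polynomials and their zeros *)

Section HermitianPolynomials.
Variable C : numClosedFieldType.
Implicit Types (p q r s : {poly {poly C}}) (f g h : {poly C}) (F G : seq {poly C}).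

Local Notation cj := (@Num.conj C).

(** The involution taking c_ab to the conjugate of c_ba. As a ring morphism it makes Hermitian
    symmetry a fixed point condition, stable under products and exact division. *)
Definition star p : {poly {poly C}} := map_poly (map_poly cj) (swapXY p).

Lemma coef_star p a b : (star p)`_a`_b = (p`_b`_a)^*.
Proof. by rewrite !coef_map /= coef_swapXY. Qed.

HB.instance Definition _ := GRing.RMorphism.copy star
  ((map_poly (map_poly cj) : {rmorphism _ -> _}) \o @swapXY C).

Lemma hermsymP p : hermsym p <-> star p = p.
Proof.
split=> [hp | hp a b].
  by apply/polyP=> a; apply/polyP=> b; rewrite coef_star; apply/esym/hp.
by rewrite /hcoef -coef_star hp.
Qed.

Lemma starK : involutive star.
Proof.
by move=> p; apply/polyP=> a; apply/polyP=> b; rewrite !coef_star conjCK.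
Qed.

Lemma hvalE p z : hval p z = p.[z%:P].[z^*].
Proof.
rewrite /hval (_ : map_poly _ p = map_poly (horner_eval z^*) p) //.
by rewrite -[X in _.[X]](_ : horner_eval z^* z%:P = z) ?horner_map ?horner_evalE ?hornerC.
Qed.

Lemma hvalM p q z : hval (p * q) z = hval p z * hval q z.
Proof. by rewrite !hvalE !hornerM. Qed.

Lemma hval_sum (I : Type) (t : seq I) (P : pred I) (T : I -> {poly {poly C}}) z :
  hval (\sum_(i <- t | P i) T i) z = \sum_(i <- t | P i) hval (T i) z.
Proof. by rewrite hvalE !horner_sum; apply: eq_bigr => i _; rewrite hvalE. Qed.

Lemma hval_coef p n z : (size p <= n)%N -> (forall a, (size (p`_a)%R <= n)%N) ->
  hval p z = \sum_(a < n) \sum_(b < n) p`_a`_b * (z ^+ a * z^* ^+ b).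
Proof.
move=> pn pan; rewrite hvalE (horner_coef_wide _ pn) horner_sum.
apply: eq_bigr => a _; rewrite hornerM (horner_coef_wide _ (pan a)) -polyC_exp hornerC.
by rewrite mulr_suml; apply: eq_bigr => b _; rewrite mulrAC mulrA.
Qed.

Lemma hsqE h : hsq h = map_poly polyC h * (map_poly cj h)%:P.
Proof.
apply/polyP=> a; rewrite coef_poly coefMC coef_map /= mul_polyC.
by case: ltnP => // /(nth_default 0)->; rewrite scale0r.
Qed.

Lemma coef_hsq h a b : (hsq h)`_a`_b = h`_a * (h`_b)^*.
Proof. by rewrite hsqE coefMC coef_map /= coefCM coef_map. Qed.

Lemma hsqM g h : hsq (g * h) = hsq g * hsq h.
Proof. by rewrite !hsqE !rmorphM /= mulrACA. Qed.

Lemma hsq1 : hsq 1 = 1 :> {poly {poly C}}.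
Proof. by rewrite hsqE !rmorph1 mulr1. Qed.

Lemma hsq_eq0 h : (hsq h == 0) = (h == 0).
Proof.
apply/eqP/eqP=> [h0 | ->]; last by rewrite hsqE !rmorph0 mulr0.
apply/polyP=> a; apply/eqP; rewrite coef0 -normr_eq0 -sqrf_eq0 normCK -coef_hsq.
by rewrite h0 !coef0.
Qed.

Lemma hval_hsq h z : hval (hsq h) z = `|h.[z]| ^+ 2.
Proof. by rewrite hvalE hsqE !hornerE horner_map /= hornerC horner_map normCK. Qed.

Lemma star_hsq h : star (hsq h) = hsq h.
Proof.
by apply/polyP=> a; apply/polyP=> b; rewrite coef_star !coef_hsq rmorphM /= conjCK mulrC.
Qed.

Lemma star_normsq F : star (normsq F) = normsq F.
Proof. by rewrite /normsq rmorph_sum; apply: eq_bigr => f _; apply: star_hsq. Qed.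

Lemma normsq_nil : normsq [::] = 0 :> {poly {poly C}}.
Proof. by rewrite /normsq big_nil. Qed.

Lemma normsq_cat F G : normsq (F ++ G) = normsq F + normsq G.
Proof. by rewrite /normsq big_cat. Qed.

Lemma normsq_map h F : normsq [seq h * f | f <- F] = hsq h * normsq F.
Proof.
by rewrite /normsq big_map mulr_sumr; apply: eq_bigr => f _; apply: hsqM.
Qed.

Lemma normsq1 h : normsq [:: h] = hsq h.
Proof. by rewrite /normsq big_seq1. Qed.

Lemma coef_normsq F a b : (normsq F)`_a`_b = \sum_(f <- F) f`_a * (f`_b)^*.
Proof.
by rewrite /normsq !coef_sum; apply: eq_bigr => f _; apply: coef_hsq.
Qed.

Lemma hval_normsq F z : hval (normsq F) z = \sum_(f <- F) `|f.[z]| ^+ 2.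
Proof. by rewrite /normsq hval_sum; apply: eq_bigr => f _; apply: hval_hsq. Qed.

Lemma hval_normsq_ge0 F z : 0 <= hval (normsq F) z.
Proof. by rewrite hval_normsq; apply: sumr_ge0 => f _; apply: exprn_ge0. Qed.

Lemma psum_normsq_eq0 F (T : {poly C} -> C) :
  (\sum_(f <- F) `|T f| ^+ 2 == 0) = all (fun f => T f == 0) F.
Proof.
rewrite psumr_eq0 ?big_all; last by move=> f _; apply: exprn_ge0.
by apply: eq_all => f; rewrite sqrf_eq0 normr_eq0.
Qed.

(** The diagonal coefficients of [normsq F] are sums of squared moduli. *)
Lemma normsq_eq0 F : (normsq F == 0) = all (fun f => f == 0) F.
Proof.
apply/eqP/allP=> [F0 f fF | F0].
  apply/eqP/polyP=> a; rewrite coef0.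
  have /eqP := coef_normsq F a a; rewrite F0 !coef0 eq_sym.
  rewrite (eq_bigr (fun f : {poly C} => `|f`_a| ^+ 2)); last by move=> ? _; rewrite normCK.
  by rewrite (psum_normsq_eq0 F (fun f => f`_a)) => /allP/(_ _ fF)/eqP.
rewrite /normsq big_seq big1 // => f /F0/eqP->.
by apply/eqP; rewrite hsq_eq0.
Qed.

Lemma has_normsq F : has (fun f => f != 0) F = (normsq F != 0).
Proof. by rewrite normsq_eq0 -has_predC. Qed.

Lemma star_divl h p q : h != 0 -> star q = q -> q = hsq h * p -> star p = p.
Proof.
move=> h0 qs qE; apply: (@mulfI _ (hsq h)); first by rewrite hsq_eq0.
by rewrite -{1}star_hsq -rmorphM -qE /= qs.
Qed.

Lemma size_coef_herm p a : star p = p -> (size (p`_a)%R <= size p)%N.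
Proof.
move=> ps; apply/leq_sizeP => b pb.
by rewrite -ps coef_star [p`_b]nth_default // coef0 rmorph0.
Qed.

Lemma hval_real p z : star p = p -> hval p z \is Num.real.
Proof.
move=> ps; rewrite CrealE; apply/eqP.
rewrite (@hval_coef p (size p)) // => [|a]; last exact: size_coef_herm.
rewrite rmorph_sum exchange_big; apply: eq_bigr => a _ /=.
rewrite rmorph_sum; apply: eq_bigr => b _ /=.
by rewrite !rmorphM /= !rmorphXn /= conjCK -coef_star ps [z ^+ _ * _]mulrC.
Qed.

(** The root holds identically in wbar, so a linear factor in z splits off; [star] turns it into its
    conjugate in wbar, which is prime to it, so both divide p. *)
Lemma herm_factor p z : star p = p -> root p z%:P ->
  exists q, p = hsq ('X - z%:P) * q /\ (p != 0 -> (size q < size p)%N).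
Proof.
move=> ps /factor_theorem[q pE].
pose M : {poly C} := 'X - (z^*)%:P.
have ME : star ('X - z%:P%:P) = M%:P.
  rewrite rmorphB /= /star swapXY_X swapXY_polyC !map_polyC /= map_polyX map_polyC.
  exact/esym/polyCB.
have hE : hsq ('X - z%:P) = ('X - z%:P%:P) * M%:P.
  by rewrite hsqE !rmorphB /= !map_polyX !map_polyC; congr (_ * _); apply/esym/polyCB.
have M0 : M != 0 by rewrite polyXsubC_eq0.
(* [M%:P] is a nonzero constant in the outer variable, so the root must come from [star q]. *)
have : root (star q * M%:P) z%:P by rewrite -ME -rmorphM -pE /= ps pE rootM root_XsubC eqxx orbT.
rewrite rootM rootC (negPf M0) orbF => /factor_theorem[q1 qE].
have qE' : q = star q1 * M%:P by rewrite -[q]starK qE rmorphM /= ME.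
have pE' : p = hsq ('X - z%:P) * star q1.
  by rewrite pE qE' hE; ring.
exists (star q1); split=> // p0.
have q10 : star q1 != 0 by apply/eqP=> e0; case/eqP: p0; rewrite pE' e0 mulr0.
have q0 : q != 0 by apply/eqP=> e0; case/eqP: p0; rewrite pE e0 mul0r.
rewrite pE size_Mmonic ?monicXsubC ?size_XsubC ?addn2 //=.
by rewrite qE' size_mul ?polyC_eq0 // size_polyC M0 addn1.
Qed.

Lemma normsq_factor F z : hval (normsq F) z = 0 ->
  exists G, normsq F = hsq ('X - z%:P) * normsq G.
Proof.
move/eqP; rewrite hval_normsq (psum_normsq_eq0 F (fun f => f.[z])) => /allP F0.
exists [seq f %/ ('X - z%:P) | f <- F].
rewrite -normsq_map -map_comp; congr normsq; rewrite -[LHS]map_id.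
apply/eq_in_map => f /F0; rewrite -/(root f z) -dvdp_XsubCl => /divpK {1}<- /=.
by rewrite mulrC.
Qed.

(** Induction on the sizes of r and s. A zero a of r is a common zero of F, so |z - a|^2 divides
    [normsq F]; it is removed either from r, where it joins h, or from s. *)
Lemma quotient_zero_free r s F :
  star r = r -> star s = s -> r != 0 -> s != 0 -> r * s = normsq F ->
  exists h R s' G, [/\ h != 0, r = hsq h * R, star R = R, star s' = s' &
    [/\ s' != 0, R * s' = normsq G & forall z, hval R z != 0]].
Proof.
have [n] := ubnP (size r + size s); elim: n => // n IHn in r s F *.
move=> rs_n rh sh r0 s0 rsE.
have [[z rz0] | r_zero_free] := pselect (exists z, hval r z = 0); last first.
  exists 1, r, s, F; rewrite oner_eq0 hsq1 mul1r; split=> //; split=> // z.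
  by apply/eqP=> rz0; apply: r_zero_free; exists z.
have [G FE] : exists G, normsq F = hsq ('X - z%:P) * normsq G.
  by apply: normsq_factor; rewrite -rsE hvalM rz0 mul0r.
have L0 : 'X - z%:P != 0 :> {poly C} by rewrite polyXsubC_eq0.
(* Vanishing of r at one point yields no linear factor by itself. But the product vanishes
   identically in wbar, and over the domain [{poly C}] one of its factors must do so. *)
have: root (r * s) z%:P.
  by rewrite rsE FE hsqE rmorphB /= map_polyX map_polyC !rootM root_XsubC eqxx.
rewrite rootM => /orP[] /herm_factor[] // q [qE ltq].
- have qh : star q = q by apply: star_divl L0 rh qE.
  have q0 : q != 0 by apply/eqP=> e0; case/eqP: r0; rewrite qE e0 mulr0.
  have qsE : q * s = normsq G.
    by apply: (@mulfI _ (hsq ('X - z%:P))); rewrite ?hsq_eq0 // mulrA -qE rsE.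
  have [|h [R [s' [G' [h0 qR ? ? ?]]]]] := IHn q s G _ qh sh q0 s0 qsE.
    by rewrite -ltnS (leq_trans _ rs_n) // !ltnS ltn_add2r ltq.
  exists (('X - z%:P) * h), R, s', G'; split=> //; first by rewrite mulf_neq0.
  by rewrite qE qR hsqM mulrA.
- have qh : star q = q by apply: star_divl L0 sh qE.
  have q0 : q != 0 by apply/eqP=> e0; case/eqP: s0; rewrite qE e0 mulr0.
  have rqE : r * q = normsq G.
    by apply: (@mulfI _ (hsq ('X - z%:P))); rewrite ?hsq_eq0 // mulrCA -qE rsE.
  apply: (IHn r q G) => //.
  by rewrite -ltnS (leq_trans _ rs_n) // !ltnS ltn_add2l ltq.
Qed.

(** If this coefficient vanished, so would the top diagonal coefficient of [normsq F]. That is the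
    sum of the |f_(m+k)|^2, so the whole leading coefficient of [normsq F] in z would vanish. *)
Lemma quotient_diag_coef r s F :
  star r = r -> star s = s -> r != 0 -> s != 0 -> r * s = normsq F ->
  r`_(degz r)`_(degz r) != 0.
Proof.
move=> rh sh r0 s0 rsE; apply/eqP=> rmm0.
set m := degz r in rmm0 *; set k := (size s).-1.
have szr : size r = m.+1 by rewrite prednK // size_poly_gt0.
have szs : size s = k.+1 by rewrite prednK // size_poly_gt0.
have szrs : (size (r * s)).-1 = (m + k)%N by rewrite size_mul // szr szs addSn addnS.
have lcE : (normsq F)`_(m + k) = r`_m * s`_k.
  by rewrite -rsE -szrs -lead_coefE lead_coefM !lead_coefE szr szs.
have : (normsq F)`_(m + k) != 0 by rewrite -rsE -szrs -lead_coefE lead_coef_eq0 mulf_neq0.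
have szrm : (size (r`_m)%R <= m)%N.
  apply/leq_sizeP => j; rewrite leq_eqVlt => /predU1P[<- //|mj].
  by rewrite nth_default // (leq_trans (size_coef_herm _ rh)) // szr.
have szsk : (size (s`_k)%R <= k.+1)%N by rewrite -szs size_coef_herm.
have Fn0 : (normsq F)`_(m + k)`_(m + k) = 0.
  apply: nth_default; rewrite lcE (leq_trans (size_polyMleq _ _)) //.
  have [->|] := eqVneq (size (r`_m)%R) 0%N; last by lia.
  by lia.
move/eqP: Fn0; rewrite coef_normsq.
rewrite (eq_bigr (fun f : {poly C} => `|f`_(m + k)| ^+ 2)); last by move=> ? _; rewrite normCK.
rewrite (psum_normsq_eq0 F (fun f => f`_(m + k))) => /allP F0 /eqP[].
apply/polyP=> b; rewrite coef0 coef_normsq big_seq big1 // => f /F0/eqP->.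
by rewrite mul0r.
Qed.

(** By symmetry both exponents are at most m, so total degree 2m is reached only at the monomial (m,
    m). *)
Lemma totdeg_diag p : star p = p -> p != 0 ->
  totdeg p = (2 * degz p)%N <-> p`_(degz p)`_(degz p) != 0.
Proof.
move=> ps p0; rewrite /degz; set m := (size p).-1.
have szp : size p = m.+1 by rewrite prednK // size_poly_gt0.
have le_m (a : nat) : ((size (p`_a)%R).-1 <= m)%N.
  by rewrite -ltnS -szp; have := size_coef_herm a ps; rewrite szp; case: size.
have pm0 : p`_m != 0 by rewrite -[m]/(size p).-1 -lead_coefE lead_coef_eq0.
have m_lt : (m < size p)%N by rewrite szp.
rewrite /totdeg; split=> [totE | pmm].
  have [|i pi0] := @eq_bigmax_cond _ (fun a : 'I_(size p) => p`_a != 0)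
      (fun a : 'I_(size p) => (a + (size (p`_a)%R).-1)%N).
    by apply/card_gt0P; exists (Ordinal m_lt).
  rewrite totE => iE; have := le_m i; have := ltn_ord i; rewrite {2}szp ltnS => im si.
  have im' : i = m :> nat by lia.
  have smE : (size (p`_m)%R).-1 = m by rewrite im' in iE; lia.
  by rewrite -{2}smE -lead_coefE lead_coef_eq0.
apply/eqP; rewrite eqn_leq; apply/andP; split.
  apply/bigmax_leqP => i _; have := le_m i; have := ltn_ord i; rewrite {2}szp ltnS; lia.
apply: leq_trans (leq_bigmax_cond (Ordinal m_lt) pm0) => /=.
have : (m < size (p`_m)%R)%N by rewrite ltnNge; apply: contraNN pmm => /leq_sizeP->.
by case: size => // k; rewrite ltnS mul2n -addnn leq_add2l.
Qed.

(** Continuity at [z0] with a rate, expressed by the norm of the field alone; restricting to the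
    unit disc makes it stable under products. *)
Definition locally_lipschitz (z0 : C) (phi : C -> C) :=
  exists2 M, 0 <= M & forall z, `|z - z0| <= 1 -> `|phi z - phi z0| <= M * `|z - z0|.

Lemma locally_lipschitz_cst z0 c : locally_lipschitz z0 (fun=> c).
Proof. by exists 0 => // z _; rewrite subrr normr0 mul0r. Qed.

Lemma locally_lipschitzD z0 phi psi : locally_lipschitz z0 phi ->
  locally_lipschitz z0 psi -> locally_lipschitz z0 (fun z => phi z + psi z).
Proof.
move=> [M M0 phiM] [N N0 psiN]; exists (M + N); first exact: addr_ge0.
move=> z z1; rewrite opprD addrACA mulrDl.
by apply: le_trans (ler_normD _ _) _; rewrite lerD ?phiM ?psiN.
Qed.

Lemma locally_lipschitzM z0 phi psi : locally_lipschitz z0 phi ->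
  locally_lipschitz z0 psi -> locally_lipschitz z0 (fun z => phi z * psi z).
Proof.
move=> [M M0 phiM] [N N0 psiN].
exists (M * N + M * `|psi z0| + N * `|phi z0|).
  by rewrite !addr_ge0 ?mulr_ge0.
move=> z z1.
have -> : phi z * psi z - phi z0 * psi z0 = (phi z - phi z0) * (psi z - psi z0)
  + (phi z - phi z0) * psi z0 + (psi z - psi z0) * phi z0 by ring.
have phiz := phiM z z1; have psiz := psiN z z1.
have psiz' : `|psi z - psi z0| <= N by apply: le_trans psiz _; rewrite ler_piMr.
rewrite [leRHS]mulrDl [X in _ <= X + _]mulrDl.
apply: le_trans (ler_normD _ _) _; apply: lerD; last first.
  by rewrite normrM [leRHS]mulrAC ler_wpM2r.
apply: le_trans (ler_normD _ _) _; apply: lerD; last first.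
  by rewrite normrM [leRHS]mulrAC ler_wpM2r.
by rewrite normrM [leRHS]mulrAC ler_pM.
Qed.

Lemma locally_lipschitz_horner z0 phi f : locally_lipschitz z0 phi ->
  locally_lipschitz z0 (fun z => f.[phi z]).
Proof.
move=> lphi; elim/poly_ind: f => [|f c IHf].
  rewrite (_ : (fun _ => _) = fun=> 0); first exact: locally_lipschitz_cst.
  by apply/funext => z; rewrite horner0.
rewrite (_ : (fun _ => _) = fun z => f.[phi z] * phi z + c).
  by apply: locally_lipschitzD (locally_lipschitz_cst _ _); apply: locally_lipschitzM.
by apply/funext=> z; rewrite !hornerE.
Qed.

Lemma locally_lipschitz_hval z0 p : locally_lipschitz z0 (hval p).
Proof.
elim/poly_ind: p => [|p f IHp].
  rewrite (_ : hval _ = fun=> 0); first exact: locally_lipschitz_cst.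
  by apply/funext => z; rewrite hvalE !horner0.
rewrite (_ : hval _ = fun z => hval p z * z + f.[z^*]).
  apply: locally_lipschitzD; first apply: locally_lipschitzM => //.
    by exists 1 => // z _; rewrite mul1r.
  apply: locally_lipschitz_horner; exists 1 => // z _.
  by rewrite mul1r -rmorphB /= norm_conjC.
by apply/funext=> z; rewrite !hvalE !hornerE /=.
Qed.

(* A negative value at [z0] would persist on a neighbourhood, hence at some
   point outside the finitely many roots of [h]. *)
Lemma hval_ge0_dense p h : star p = p -> h != 0 ->
  (forall z, h.[z] != 0 -> 0 <= hval p z) -> forall z, 0 <= hval p z.
Proof.
move=> ps h0 p_ge0 z0; rewrite real_leNgt ?real0 ?hval_real //.
apply/negP => pz0; have [M M0 pM] := locally_lipschitz_hval z0 p.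
(* This radius ensures [e <= 1] and [M * e < - hval p z0] at once, also when M = 0. *)
pose e := - hval p z0 / (M - hval p z0).
have d0 : 0 < M - hval p z0 by rewrite subr_gt0 (lt_le_trans pz0).
have e0 : 0 < e by rewrite divr_gt0 ?oppr_gt0.
have e1 : e <= 1 by rewrite ler_pdivrMr // mul1r lerDr.
have Me : M * e < - hval p z0.
  rewrite mulrA ltr_pdivrMr // mulrBr -subr_gt0.
  rewrite (_ : _ - _ = hval p z0 * hval p z0); last by ring.
  by rewrite nmulr_lgt0.
(* Distinct points within distance e of [z0]; among the first [size h] of them one is not a root of
   h. *)
pose t (k : nat) := z0 + e / k.+1%:R.
have tinj : injective t.
  move=> j k /addrI/(mulfI (lt0r_neq0 e0))/invr_inj/eqP.
  by rewrite eqr_nat => /eqP[].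
have /allPn[k] : ~~ all (root h) (map t (iota 0 (size h))).
  apply/negP=> /(max_poly_roots h0); rewrite size_map size_iota ltnn map_inj_uniq //.
  by rewrite iota_uniq => /(_ isT).
case/mapP=> {}k _ -> /p_ge0 ptk.
have tE : `|t k - z0| = e / k.+1%:R.
  by rewrite /t addrAC subrr add0r ger0_norm // ltW // divr_gt0.
have te : `|t k - z0| <= e by rewrite tE ler_piMr ?(ltW e0) // invf_le1 // ler1n.
have := pM _ (le_trans te e1); apply/negP; rewrite -real_ltNge ?realM ?normr_real ?ger0_real //.
have Mte : M * `|t k - z0| < - hval p z0 by apply: le_lt_trans Me; rewrite ler_wpM2l.
apply: lt_le_trans Mte _.
by rewrite ger0_norm ?lerDr // addr_ge0 // oppr_ge0 ltW.
Qed.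

(* [hval p (z^-1)] times [|z|^(2m)] is a polynomial with value [c_mm] at 0. *)
Lemma diag_coef_gt0 p : star p = p -> (forall z, 0 < hval p z) ->
  p`_(degz p)`_(degz p) != 0 -> 0 < p`_(degz p)`_(degz p).
Proof.
move=> ps p_gt0 pmm0; rewrite lt0r pmm0 /=; set m := degz p.
have szp : (size p <= m.+1)%N by apply: leqSpred.
pose P : {poly {poly C}} := \poly_(a < m.+1) \poly_(b < m.+1) p`_(m - a)`_(m - b).
have PE a b : P`_a`_b = if (a < m.+1)%N && (b < m.+1)%N then p`_(m - a)`_(m - b) else 0.
  by rewrite coef_poly; case: ltnP => _; rewrite ?coef0 // coef_poly.
have Ps : star P = P.
  apply/polyP=> a; apply/polyP=> b; rewrite coef_star !PE andbC.
  by case: ifP => _; rewrite ?rmorph0 // -coef_star ps.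
have szPa a : (size (P`_a)%R <= m.+1)%N.
  by apply/leq_sizeP=> b; rewrite PE leqNgt => /negPf->; rewrite andbF.
have -> : p`_m`_m = hval P 0 by rewrite hvalE conjC0 polyC0 !horner_coef0 PE /= !subn0.
apply: (@hval_ge0_dense P 'X) => // [|z]; first by rewrite polyX_eq0.
rewrite hornerX => z0.
rewrite (hval_coef _ (size_poly _ _) szPa).
have -> : \sum_(a < m.+1) \sum_(b < m.+1) P`_a`_b * (z ^+ a * z^* ^+ b)
    = z ^+ m * z^* ^+ m * hval p z^-1.
  rewrite (hval_coef _ szp) => [|a]; last by apply: leq_trans (size_coef_herm _ ps) szp.
  rewrite (reindex_inj rev_ord_inj) mulr_sumr; apply: eq_bigr => a _ /=.
  rewrite (reindex_inj rev_ord_inj) mulr_sumr; apply: eq_bigr => b _ /=.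
  have [am bm] : (a <= m)%N /\ (b <= m)%N by split; rewrite -ltnS.
  rewrite !subSS PE !ltnS !leq_subr !subKn //=.
  rewrite fmorphV !exprVn !exprB ?unitfE ?conjC_eq0 //.
  by ring.
by rewrite mulr_ge0 ?(ltW (p_gt0 _)) // -exprMn exprn_ge0 // mul_conjC_ge0.
Qed.

(** Division by |h|^2 keeps the sign off the roots of h, density extends it to every point, and the
    absence of zeros makes it strict. *)
Lemma exists_positive_quotient r : star r = r -> (forall z, 0 <= hval r z) ->
  (exists s F, [/\ star s = s, s != 0 & r * s = normsq F]) ->
  exists h p, [/\ star p = p, r = hsq h * p, forall z, 0 < hval p z
    & totdeg p = (2 * degz p)%N].
Proof.
move=> rs r_ge0 [s [F [ss s0 rsE]]].
have [->|r0] := eqVneq r 0.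
  exists 0, 1; rewrite rmorph1 mulr1; split=> //.
  - by apply/esym/eqP; rewrite hsq_eq0.
  - by move=> z; rewrite hvalE !hornerC.
  - apply/totdeg_diag; rewrite ?rmorph1 ?oner_eq0 //.
    by rewrite /degz size_poly1 !coefC /= oner_eq0.
have [h [p [s' [G [h0 rE ps s's [s'0 psE pnz]]]]]] := quotient_zero_free rs ss r0 s0 rsE.
have p0 : p != 0 by apply/eqP=> e0; case/eqP: r0; rewrite rE e0 mulr0.
exists h, p; split=> //.
  move=> z; rewrite lt0r pnz; apply: (hval_ge0_dense ps h0) => {}z hz.
  have := r_ge0 z; rewrite rE hvalM hval_hsq pmulr_rge0 //.
  by rewrite exprn_gt0 // normr_gt0.
by apply/totdeg_diag => //; apply: (quotient_diag_coef ps s's p0 s'0 psE).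
Qed.

End HermitianPolynomials.

(** * Squared norms and words of linear forms *)

Section SumsOfSquares.
Variable C : numClosedFieldType.

Definition sos (p : {poly {poly C}}) := exists F, p = normsq F.

Lemma sos_hsq h : sos (hsq h).
Proof. by exists [:: h]; rewrite normsq1. Qed.

Lemma sosD p q : sos p -> sos q -> sos (p + q).
Proof. by move=> [F ->] [G ->]; exists (F ++ G); rewrite normsq_cat. Qed.

Lemma sos_sum (I : Type) (t : seq I) (P : pred I) (f : I -> {poly {poly C}}) :
  (forall i, P i -> sos (f i)) -> sos (\sum_(i <- t | P i) f i).
Proof.
by move=> fs; elim/big_ind: _ => //; [exists [::]; rewrite normsq_nil | apply: sosD].
Qed.

Lemma sosM p q : sos p -> sos q -> sos (p * q).
Proof.
move=> [F ->] [G ->]; rewrite /normsq mulr_suml; apply: sos_sum => f _.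
by exists [seq f * g | g <- G]; rewrite normsq_map.
Qed.

Lemma sos_prod (I : Type) (t : seq I) (P : pred I) (f : I -> {poly {poly C}}) :
  (forall i, P i -> sos (f i)) -> sos (\prod_(i <- t | P i) f i).
Proof.
by move=> fs; elim/big_ind: _ => //; [rewrite -hsq1; apply: sos_hsq | apply: sosM].
Qed.

Lemma sosX p n : sos p -> sos (p ^+ n).
Proof. by move=> ps; rewrite -[n]card_ord -prodr_const; apply: sos_prod. Qed.

Lemma sosMn p n : sos p -> sos (p *+ n).
Proof. by move=> ps; rewrite -[n]card_ord -sumr_const; apply: sos_sum. Qed.

Lemma sosC (c : C) : 0 <= c -> sos c%:P%:P.
Proof.
move=> c0; exists [:: (sqrtC c)%:P]; rewrite normsq1 hsqE !map_polyC /= -!rmorphM /=.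
by rewrite -normCK ger0_norm ?sqrtC_ge0 // sqrtCK.
Qed.

Lemma herm_sum (p : {poly {poly C}}) n : (size p <= n)%N -> (forall a, (size (p`_a)%R <= n)%N) ->
  p = \sum_(a < n) \sum_(b < n) (p`_a`_b)%:P%:P * ('X ^+ a * 'X%:P ^+ b).
Proof.
move=> pn pan; rewrite -{1}(coefK p) (poly_def (size p)).
rewrite (big_ord_widen n (fun a => p`_a *: 'X^a) pn) big_mkcond.
apply: eq_bigr => a _; case: ltnP => [_|/(nth_default 0)->]; last first.
  by rewrite big1 // => b _; rewrite coef0 !polyC0 mul0r.
rewrite -mul_polyC -{1}(coefK p`_a) poly_def rmorph_sum mulr_suml /=.
rewrite (big_ord_widen n (fun b => (p`_a`_b *: 'X^b)%:P * 'X^a) (pan a)) big_mkcond.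
apply: eq_bigr => b _; case: ltnP => [_|/(nth_default 0)->]; last by rewrite !polyC0 mul0r.
by rewrite -mul_polyC rmorphM rmorphXn /= -mulrA ['X^a * _]mulrC.
Qed.

End SumsOfSquares.

Section LinearForms.
Variables (K A : comNzRingType) (iota : {rmorphism K -> A}) (I : finType) (x : I -> A).

(** Coefficients pass through [iota], so that one form can be evaluated at numbers and at Hermitian
    polynomials alike. *)
Definition lin_eval (l : I -> K) : A := \sum_i iota (l i) * x i.

Lemma lin_eval1 : lin_eval (fun=> 1) = \sum_i x i.
Proof. by apply: eq_bigr => i _; rewrite rmorph1 mul1r. Qed.

Lemma lin_eval_coord j : lin_eval (fun i => (i == j)%:R) = x j.
Proof.
rewrite /lin_eval (bigD1 j) //= eqxx rmorph1 mul1r big1 ?addr0 // => i /negPf->.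
by rewrite rmorph0 mul0r.
Qed.

Lemma lin_evalD l l' : lin_eval (fun i => l i + l' i) = lin_eval l + lin_eval l'.
Proof.
by rewrite -big_split; apply: eq_bigr => i _; rewrite rmorphD mulrDl.
Qed.

Lemma lin_evalN l : lin_eval (fun i => - l i) = - lin_eval l.
Proof. by rewrite -sumrN; apply: eq_bigr => i _; rewrite rmorphN mulNr. Qed.

Lemma lin_evalZ c l : lin_eval (fun i => c * l i) = iota c * lin_eval l.
Proof. by rewrite mulr_sumr; apply: eq_bigr => i _; rewrite rmorphM mulrA. Qed.

(** A form of degree d is stored as a tensor, one coefficient per word of d letters, which avoids
    multinomial coefficients. By distributivity a product of linear forms has the product of their
    coefficients as tensor. *)
Lemma sum_words_linear (T : finType) d (a : T -> K) (l : T -> nat -> I -> K) :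
  \sum_(w : {ffun 'I_d -> I}) iota (\sum_t a t * \prod_(k < d) l t k (w k)) * \prod_k x (w k)
  = \sum_t iota (a t) * \prod_(k < d) lin_eval (l t k).
Proof.
under eq_bigr do rewrite rmorph_sum mulr_suml /=.
rewrite exchange_big; apply: eq_bigr => t _ /=.
rewrite bigA_distr_bigA mulr_sumr; apply: eq_bigr => w _ /=.
by rewrite rmorphM rmorph_prod -mulrA -big_split.
Qed.

End LinearForms.

Section MonomialFactors.
Variables (T : Type) (D B B' A S : T) (m a b : nat).

(* Factors of a bihomogeneous monomial, laid out so that exchanging [a] with
   [b] only exchanges [B] with [B']. *)
Definition mono_factor (k : nat) : T :=
  if (k < minn a b)%N then D else if (k < a)%N then B
  else if (k < b)%N then B' else if (k < m)%N then A else S.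

End MonomialFactors.

(** Cut the range at min(a, b), max(a, b) and m: the factor is constant on each block. *)
Lemma prod_mono_factor (T : comNzRingType) (D B B' A S : T) m a b e :
  (a <= m)%N -> (b <= m)%N ->
  \prod_(k < e + m) mono_factor D B B' A S m a b k
  = D ^+ minn a b * B ^+ (a - b) * B' ^+ (b - a) * A ^+ (m - maxn a b) * S ^+ e.
Proof.
move=> am bm; rewrite addnC; set G := mono_factor _ _ _ _ _ _ _ _.
have Gconst p q X : (forall k, (p <= k < q)%N -> G k = X) ->
    \prod_(p <= k < q) G k = X ^+ (q - p).
  by move=> GX; rewrite (eq_big_nat _ _ GX) prodr_const_nat.
rewrite -(big_mkord xpredT G) (@big_cat_nat _ _ _ (minn a b)) //=; last by lia.
rewrite (@big_cat_nat _ _ _ (maxn a b) (minn a b)) //=; [|lia|lia].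
rewrite (@big_cat_nat _ _ _ m (maxn a b)) //=; [|lia|lia].
rewrite (Gconst 0%N _ D) => [|k]; last by rewrite /G /mono_factor; case: ifP => //; lia.
rewrite (Gconst _ m A) => [|k]; last first.
  by rewrite /G /mono_factor; do ?[case: ifP => //]; lia.
rewrite (Gconst m _ S) => [|k]; last first.
  by rewrite /G /mono_factor; do ?[case: ifP => //]; lia.
rewrite subn0 addKn !mulrA; congr (_ * _ * _); rewrite -!mulrA; congr (_ * _).
(* The middle block carries only B or only B'; the other exponent is 0 by truncated subtraction. *)
have [ab | ba] := leqP a b.
  rewrite (Gconst _ _ B') => [|k]; last first.
    by rewrite /G /mono_factor; do ?[case: ifP => //]; lia.
  by rewrite (eqP (_ : (a - b)%N == 0%N)) ?subn_eq0 // expr0 mul1r.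
rewrite (Gconst _ _ B) => [|k]; last first.
  by rewrite /G /mono_factor; do ?[case: ifP => //]; lia.
by rewrite (eqP (_ : (b - a)%N == 0%N)) ?subn_eq0 ?(ltnW ba) // expr0 mulr1.
Qed.

(** The left side is the monomial at the rank one matrix A = t, B = tz, B' = tw, D = tzw. *)
Lemma mono_rank1 (T : comNzRingType) (t z w : T) m a b : (a <= m)%N -> (b <= m)%N ->
  (t * z * w) ^+ minn a b * (t * z) ^+ (a - b) * (t * w) ^+ (b - a) * t ^+ (m - maxn a b)
  = t ^+ m * (z ^+ a * w ^+ b).
Proof.
move=> am bm; rewrite !exprMn.
have aE : (minn a b + (a - b) = a)%N by lia.
have bE : (minn a b + (b - a) = b)%N by lia.
have mE : (minn a b + (a - b) + (b - a) + (m - maxn a b) = m)%N by lia.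
have -> : z ^+ a = z ^+ minn a b * z ^+ (a - b) by rewrite -exprD aE.
have -> : w ^+ b = w ^+ minn a b * w ^+ (b - a) by rewrite -exprD bE.
by rewrite -[in t ^+ m]mE !exprD; ring.
Qed.

(** * Polya's theorem *)

Section Words.
Variable I : finType.

(** The positions [s k] carry a word of length d; each of the n - d others is free and contributes
    the sum of all [x i]. *)
Lemma sum_words_inj (A : comNzRingType) (d n : nat) (x : I -> A)
    (c : {ffun 'I_d -> I} -> A) (s : {ffun 'I_d -> 'I_n}) : injective s ->
  \sum_(v : {ffun 'I_n -> I}) c [ffun k => v (s k)] * \prod_i x (v i)
  = (\sum_w c w * \prod_k x (w k)) * (\sum_i x i) ^+ (n - d).
Proof.
move=> sI; rewrite (partition_big (fun v : {ffun 'I_n -> I} => [ffun k => v (s k)]) xpredT) //=.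
rewrite mulr_suml; apply: eq_bigr => w _.
(* The letter i is allowed at position j. The words that restrict to w form a product set, so their
   sum factors over positions. *)
pose Q (j : 'I_n) (i : I) := [forall k, (s k == j) ==> (i == w k)].
rewrite (eq_bigr (fun v : {ffun 'I_n -> I} => c w * \prod_i x (v i))); last first.
  by move=> v /eqP <-.
rewrite -mulr_sumr -mulrA; congr (_ * _).
rewrite (eq_bigl (fun v => v \in family Q)); last first.
  move=> v; apply/eqP/familyP => [vw j | vQ].
    by apply/forallP=> k; apply/implyP=> /eqP<-; rewrite -vw ffunE.
  by apply/ffunP=> k; rewrite ffunE; have /forallP/(_ k) := vQ (s k); rewrite eqxx => /eqP.
rewrite -(bigA_distr_big_dep _ (fun (j : 'I_n) i => x i)) (bigID [in s @: 'I_d]) /=; congr (_ * _).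
  rewrite big_imset /=; last by move=> ? ? _ _; apply: sI.
  apply: eq_bigr => k _; rewrite (eq_bigl (pred1 (w k))) ?big_pred1_eq // => i.
  apply/forallP/eqP => [/(_ k)|-> k']; first by rewrite eqxx => /eqP.
  by apply/implyP=> /eqP/sI->.
rewrite (eq_bigr (fun=> \sum_i x i)) => [|j js].
  rewrite prodr_const; congr (_ ^+ _).
  have := cardC [in s @: 'I_d]; rewrite [X in (X + _)%N](card_imset _ sI) !card_ord.
  by move=> e; apply/eqP; rewrite -(eqn_add2l d) e subnKC // -e leq_addr.
apply: eq_bigl => i; apply/forallP => k; apply/implyP => /eqP skj.
by rewrite -skj imset_f in js.
Qed.

(** With positions chosen independently, repetitions allowed, w is read off v in as many ways as the
    product of the numbers of occurrences of its letters. *)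
Lemma sum_words_all (A : comNzRingType) (d n : nat) (c : {ffun 'I_d -> I} -> A)
    (v : {ffun 'I_n -> I}) :
  \sum_(s : {ffun 'I_d -> 'I_n}) c [ffun k => v (s k)]
  = \sum_w c w * \prod_k (#|[pred j | v j == w k]|%:R).
Proof.
rewrite (partition_big (fun s : {ffun 'I_d -> 'I_n} => [ffun k => v (s k)]) xpredT) //=.
apply: eq_bigr => w _.
rewrite (eq_bigr (fun=> c w * 1)); last by move=> s /eqP <-; rewrite mulr1.
rewrite -mulr_sumr; congr (_ * _).
rewrite [RHS](eq_bigr (fun k => \sum_(j | v j == w k) 1)); last first.
  by move=> k _; rewrite sumr_const.
rewrite (bigA_distr_big_dep (fun k j => v j == w k)) /=.
rewrite [RHS](eq_bigr (fun=> 1)) => [|s _]; last by rewrite big1.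
apply: eq_bigl => s; apply/eqP/familyP => [<- k | sw]; first by rewrite unfold_in ffunE.
by apply/ffunP=> k; rewrite ffunE; apply/eqP; apply: sw.
Qed.

(** The difference counts the non-injective maps from d points to n. One more point extends such a
    map in n ways, or repeats one of d earlier values; and d^2 + d <= (d + 1)^2. *)
Lemma leq_expn_ffact n d : (n * (n ^ d - n ^_ d) <= d ^ 2 * n ^ d)%N.
Proof.
have ffact_le k : (n ^_ k <= n ^ k)%N.
  by elim: k => // k IHk; rewrite ffactnSr expnSr leq_mul // leq_subr.
elim: d => [|d IHd]; first by rewrite subnn muln0.
have step : (n ^ d.+1 - n ^_ d.+1 <= n * (n ^ d - n ^_ d) + d * n ^ d)%N.
  rewrite ffactnSr expnS leq_subLR (mulnBr n).
  have : (n ^_ d * n <= n ^_ d * (n - d) + n ^_ d * d)%N.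
    by rewrite -mulnDr leq_mul //; lia.
  have := leq_mul (leqnn n) (ffact_le d); have := leq_mul (leqnn d) (ffact_le d).
  by rewrite ![(n ^_ d * _)%N]mulnC; lia.
apply: leq_trans (leq_mul (leqnn n) step) _; rewrite mulnDr (expnS n) [X in (_ + X <= _)%N]mulnCA.
apply: leq_trans (leq_add (leq_mul (leqnn n) IHd) (leqnn _)) _.
rewrite -!mulnn; move: (n ^ d)%N => a.
have -> : (n * (d * d * a) + d * (n * a) = (d * d + d) * (n * a))%N by ring.
by apply: leq_mul => //; rewrite mulSn mulnS; lia.
Qed.

Variable R : realType.

(* Averaging [c] over the injective choices of letters of a long word [v]
   differs little from averaging over all choices, which evaluates the form
   at the vector of letter frequencies of [v]. *)
Lemma polya_words (d : nat) (c : {ffun 'I_d -> I} -> R) (mu : R) : 0 < mu ->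
  (forall p : I -> R, (forall i, 0 <= p i) ->
     mu * (\sum_i p i) ^+ d <= \sum_w c w * \prod_k p (w k)) ->
  exists2 n, (d <= n)%N & forall v : {ffun 'I_n -> I},
    0 <= \sum_(s : {ffun 'I_d -> 'I_n} | injectiveb s) c [ffun k => v (s k)].
Proof.
move=> mu0 c_ge; pose M := \sum_w `|c w|.
have M0 : 0 <= M by apply: sumr_ge0.
have cM w : `|c w| <= M.
  by rewrite /M (bigD1 w) //= lerDl; apply: sumr_ge0.
(* Non-injective choices, a proportion at most d^2 / n of all, cost at most [M] each; for this n the
   main term mu n^d absorbs them. *)
pose n := (Num.bound (M * (d ^ 2)%:R / mu) + d).+1.
have nbig : M * (d ^ 2)%:R <= mu * n%:R.
  have x0 : 0 <= M * (d ^ 2)%:R / mu by rewrite divr_ge0 ?mulr_ge0 // ltW.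
  rewrite [leRHS]mulrC -ler_pdivrMr //; apply: le_trans (ltW (archi_boundP x0)) _.
  by rewrite ler_nat /n; lia.
exists n => [|v]; first by rewrite /n; lia.
have n0 : 0 < n%:R :> R by rewrite ltr0n.
rewrite -(pmulr_rge0 _ n0).
(* Counts replace frequencies, so the lower bound reads mu n^d. *)
pose cnt i : R := #|[pred j | v j == i]|%:R.
have cnt_sum : \sum_i cnt i = n%:R.
  rewrite /cnt -natr_sum; congr (_%:R); rewrite -[RHS]card_ord -sum1_card.
  rewrite (partition_big v xpredT) //=; apply: eq_bigr => i _.
  by rewrite -sum1_card.
have := c_ge cnt (fun i => ler0n _ _); rewrite -sum_words_all cnt_sum.
rewrite (bigID (fun s : {ffun 'I_d -> 'I_n} => injectiveb s)) /=.
set T := (X in X + _); set U := (X in _ + X) => TU.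
have UM : U <= M * (n ^ d - n ^_ d)%:R.
  apply: le_trans (_ : \sum_(s : {ffun 'I_d -> 'I_n} | ~~ injectiveb s) M <= _).
    by apply: ler_sum => s _; apply: le_trans (ler_norm _) _.
  rewrite sumr_const -[M *+ _]mulr_natr ler_wpM2l // ler_nat.
  have := cardC [pred s : {ffun 'I_d -> 'I_n} | injectiveb s].
  rewrite card_ffun !card_ord => <-.
  rewrite -[X in (_ - X ^_ _)%N](card_ord n) -[X in (_ - _ ^_ X)%N](card_ord d).
  rewrite -card_inj_ffuns -[X in (_ <= _ - X)%N]/(#|_|) cardsE addKn.
  by apply: eq_leq; apply: eq_card.
have nUM : n%:R * U <= M * (d ^ 2)%:R * n%:R ^+ d.
  apply: le_trans (ler_wpM2l (ltW n0) UM) _.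
  rewrite mulrCA -mulrA ler_wpM2l // -natrX -!natrM ler_nat.
  exact: leq_expn_ffact.
have nd0 : 0 <= (n%:R : R) ^+ d by rewrite exprn_ge0 // ltW.
have nTU := ler_wpM2l (ltW n0) TU; have nMn := ler_wpM2r nd0 nbig.
have {}nTU : mu * n%:R * n%:R ^+ d <= n%:R * T + n%:R * U.
  by rewrite -mulrDr; apply: le_trans nTU; rewrite mulrAC mulrC.
rewrite -(lerD2r (n%:R * U)) add0r; apply: le_trans nTU.
exact: le_trans nUM nMn.
Qed.

End Words.

(** * Compactness: a penalty makes a form positive on the simplex *)

Section CompactPenalty.
Variable R : realType.

(** The minimum e of |phi| + phi + gam on K is positive, since phi > 0 where gam = 0. Where phi < 0
    this sum is gam, so gam >= e and kappa e = M + e outweighs phi >= - M; where phi >= 0, 2 phi +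
    gam >= e gives the bound e / 2. *)
Lemma compact_penalty (T : topologicalType) (K : set T) (phi gam : T -> R) :
  (K !=set0)%classic -> compact K -> continuous phi -> continuous gam ->
  (forall x, x \in K -> 0 <= gam x) -> (forall x, x \in K -> gam x = 0 -> 0 < phi x) ->
  exists kappa mu, 0 < mu /\ forall x, x \in K -> mu <= phi x + kappa * gam x.
Proof.
move=> K0 cK cphi cgam gam0 phi0.
have cpsi : continuous (fun x => `|phi x| + phi x + gam x).
  move=> x; apply: cvgD; last exact: cgam.
  by apply: cvgD; [apply: cvg_norm; apply: cphi | apply: cphi].
have [y yK ymin] := compact_EVT_min K0 cK (continuous_subspaceT cpsi).
have [x xK xmin] := compact_EVT_min K0 cK (continuous_subspaceT cphi).
set e := (_ + _ + _) in ymin; pose M := `|phi x|.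
have e0 : 0 < e.
  rewrite /e; have := phi0 _ yK; have := gam0 _ yK; rewrite le0r.
  have := ler_norm (- phi y); rewrite normrN; have := ler_norm (phi y).
  case: eqVneq => /= [-> | _] h1 h2 => [_ /(_ erefl) | h3 _]; lra.
exists ((M + e) / e), (e / 2); split; first by rewrite divr_gt0.
move=> t tK; have := ymin _ tK; have := xmin _ tK; have := gam0 _ tK.
have phiM : - M <= phi x by rewrite lerNl /M -normrN ler_norm.
have M0 : 0 <= M by apply: normr_ge0.
set k := (M + e) / e => g0 xt et.
have k1 : 1 <= k by rewrite /k ler_pdivlMr // mul1r lerDr.
have ke : k * e = M + e by rewrite /k divfK // gt_eqF.
have kg : gam t <= k * gam t by rewrite ler_peMl.
have [pt | pt] := leP 0 (phi t); first by rewrite ger0_norm // in et; lra.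
rewrite ltr0_norm // addNr add0r in et.
have := ler_wpM2l (le_trans ler01 k1) et; rewrite ke; lra.
Qed.

Definition simplex q : set 'rV[R]_q :=
  [set p | (forall i, 0 <= p ord0 i) /\ \sum_i p ord0 i = 1]%classic.
Arguments simplex : clear implicits.

Lemma continuous_form q d (c : {ffun 'I_d -> 'I_q} -> R) :
  continuous (fun p : 'rV[R]_q => \sum_w c w * \prod_k p ord0 (w k)).
Proof.
apply: continuous_big => [|w _]; first exact: add_continuous.
have cprod : continuous (fun p : 'rV[R]_q => \prod_k p ord0 (w k)).
  by apply: continuous_big => [|k _]; [exact: mul_continuous | exact: coord_continuous].
by move=> p; exact: (cvgM (cvg_cst (c w)) (cprod p)).
Qed.

Lemma compact_simplex q : compact (simplex q).
Proof.
apply: (@subclosed_compact _ _ [set p : 'rV[R]_q | forall i, `[0, 1]%classic (p ord0 i)]%classic).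
- rewrite (_ : simplex q = (\bigcap_i [set p : 'rV[R]_q | 0 <= p ord0 i] `&`
    (fun p : 'rV[R]_q => \sum_i p ord0 i) @^-1` [set 1])%classic); last first.
    apply/seteqP; split=> p /= [p0 p1]; split=> // i; first by move=> _; apply: p0.
    exact: p0.
  apply: closedI.
    apply: closed_bigI => i _.
    apply: (@preimage_closed _ _ (fun p : 'rV[R]_q => p ord0 i) [set x | 0 <= x]%classic).
      by move=> p _; apply: coord_continuous.
    exact: closed_ge.
  apply: preimage_closed; last exact: closed_eq.
  have csum : continuous (fun p : 'rV[R]_q => \sum_i p ord0 i).
    by apply: continuous_big => [|k _]; [exact: add_continuous | exact: coord_continuous].
  by move=> p _; apply: csum.
- by apply: (@rV_compact R q (fun=> `[0, 1]%classic)) => i; apply: segment_compact.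
- move=> p [p0 p1] i /=; rewrite in_itv /= p0 -p1 (bigD1 i) //= lerDl.
  by apply: sumr_ge0.
Qed.

(** The bound on the compact simplex extends to the nonnegative orthant by homogeneity. *)
Lemma penalized_form q d (cphi cgam : {ffun 'I_d.+1 -> 'I_q.+1} -> R) :
  (forall p : 'I_q.+1 -> R, (forall i, 0 <= p i) -> \sum_i p i = 1 ->
     0 <= \sum_w cgam w * \prod_k p (w k)) ->
  (forall p : 'I_q.+1 -> R, (forall i, 0 <= p i) -> \sum_i p i = 1 ->
     \sum_w cgam w * \prod_k p (w k) = 0 -> 0 < \sum_w cphi w * \prod_k p (w k)) ->
  exists kappa mu, 0 < mu /\ forall p : 'I_q.+1 -> R, (forall i, 0 <= p i) ->
    mu * (\sum_i p i) ^+ d.+1 <= \sum_w (cphi w + kappa * cgam w) * \prod_k p (w k).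
Proof.
move=> gam0 phi0.
have S0 : (simplex q.+1 !=set0)%classic.
  exists (\row_i (i == ord0)%:R); split=> [i | ]; first by rewrite mxE.
  rewrite (bigD1 ord0) //= mxE eqxx big1 ?addr0 // => i /negPf i0.
  by rewrite mxE i0.
have [||k [mu [mu0 mu_le]]] := compact_penalty S0 (compact_simplex (q := q.+1))
    (continuous_form (c := cphi)) (continuous_form (c := cgam)).
- by move=> p /set_mem[]; apply: gam0.
- by move=> p /set_mem[]; apply: phi0.
exists k, mu; split=> // p p0; set s := \sum_i p i.
(* At the origin both sides vanish because the degree [d.+1] is positive. *)
have [s0 | s_neq0] := eqVneq s 0.
  rewrite s0 expr0n mulr0 big1 // => w _.
  have /eqP := s0; rewrite psumr_eq0 // => /allP pi0.
  by rewrite big_ord_recl (eqP (pi0 _ (mem_index_enum _))) mul0r mulr0.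
have s_gt0 : 0 < s by rewrite lt0r s_neq0 sumr_ge0.
have := mu_le (\row_i (p i / s)); rewrite inE /= => /(_ _)/wrap[].
  split=> [i | ]; first by rewrite mxE divr_ge0 // ltW.
  by rewrite (eq_bigr (fun i => p i / s)) -?mulr_suml ?mulfV // => i _; rewrite mxE.
have hom (w : {ffun 'I_d.+1 -> 'I_q.+1}) :
    \prod_k (\row_i (p i / s)) ord0 (w k) = (\prod_k p (w k)) / s ^+ d.+1.
  rewrite (eq_bigr (fun k => p (w k) / s)); last by move=> i _; rewrite mxE.
  by rewrite big_split /= prodr_const card_ord exprVn.
rewrite mulr_sumr -big_split /= -ler_pdivlMr ?exprn_gt0 // => mu_le1.
apply: le_trans mu_le1 _; rewrite mulr_suml; apply: ler_sum => w _.
by rewrite hom !mulrA -!mulrDl.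
Qed.

End CompactPenalty.

(** * Positive Hermitian polynomials are quotients of squared norms *)

Section Quillen.
Variable R : realType.
Local Notation C := R[i].
Local Notation "x %:C" := (real_complex R x) : ring_scope.

Lemma conj_real (c : R) : (c%:C)^* = c%:C.
Proof. by apply/CrealP/complex_realP; exists c. Qed.

Lemma conj_rect (a b : R) : (a%:C + 'i * b%:C)^* = a%:C - 'i * b%:C.
Proof. by rewrite rmorphD rmorphM /= conjCi !conj_real mulNr. Qed.

(* The Hermitian matrix [[A, B], [B', D]] has the coordinates
   A, D, A + D + 2 Re B, A + D + 2 Im B. *)
Definition crd (j : nat) (i : 'I_4) : R := (i == inord j)%:R.
Definition lX (i : 'I_4) : R := 2^-1 * (crd 2 i + - (crd 0 i + crd 1 i)).
Definition lY (i : 'I_4) : R := 2^-1 * (crd 3 i + - (crd 0 i + crd 1 i)).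
Definition lB (i : 'I_4) : C := (lX i)%:C + 'i * (lY i)%:C.
Definition lB' (i : 'I_4) : C := (lX i)%:C + - ('i * (lY i)%:C).

Section Values.
Variables (A : comNzRingType) (j : {rmorphism R -> A}) (x : 'I_4 -> A).
Definition vX : A := j 2^-1 * (x (inord 2) - (x (inord 0) + x (inord 1))).
Definition vY : A := j 2^-1 * (x (inord 3) - (x (inord 0) + x (inord 1))).

Lemma lin_eval_lX : lin_eval j x lX = vX.
Proof. by rewrite /lX lin_evalZ lin_evalD lin_evalN lin_evalD !lin_eval_coord. Qed.

Lemma lin_eval_lY : lin_eval j x lY = vY.
Proof. by rewrite /lY lin_evalZ lin_evalD lin_evalN lin_evalD !lin_eval_coord. Qed.

(** The three products of [gl1 s] and [gl2 s] add up to A D - X^2 - Y^2, where B = X + iY. *)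
Definition gl1 (s : 'I_3) (i : 'I_4) : R := nth 0 [:: crd 0 i; - lX i; - lY i] s.
Definition gl2 (s : 'I_3) (i : 'I_4) : R := nth 0 [:: crd 1 i; lX i; lY i] s.
(** The pair t names a term of the squared determinant; the remaining factors are the sum of all
    coordinates. *)
Definition gl (t : 'I_3 * 'I_3) (k : nat) : 'I_4 -> R :=
  match k with
  | 0 => gl1 t.1 | 1 => gl2 t.1 | 2 => gl1 t.2 | 3 => gl2 t.2 | _ => fun=> 1
  end.

(* The square of A D - |B|^2, which cuts out the rank one matrices. *)
Definition det_words m (w : {ffun 'I_m.+4 -> 'I_4}) : R :=
  \sum_t 1 * \prod_(k < m.+4) gl t k (w k).

Lemma det_wordsE m :
  \sum_w j (det_words w) * \prod_(k < m.+4) x (w k)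
  = (x (inord 0) * x (inord 1) - (vX ^+ 2 + vY ^+ 2)) ^+ 2 * (\sum_i x i) ^+ m.
Proof.
rewrite sum_words_linear; set S := \sum_i x i.
pose q s := lin_eval j x (gl1 s) * lin_eval j x (gl2 s).
rewrite (eq_bigr (fun t => q t.1 * q t.2 * S ^+ m)) => [|t _]; last first.
  rewrite rmorph1 mul1r !big_ord_recl /= -!mulrA; do 4 congr (_ * _).
  rewrite (eq_bigr (fun=> S)) ?prodr_const ?card_ord // => k _.
  exact: lin_eval1.
rewrite -mulr_suml; congr (_ * _).
rewrite -(pair_bigA _ (fun s t => q s * q t)) /=.
have -> : x (inord 0) * x (inord 1) - (vX ^+ 2 + vY ^+ 2) = \sum_s q s.
  rewrite !big_ord_recl big_ord0 /q /gl1 /gl2 /= !lin_evalN.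
  rewrite !lin_eval_coord lin_eval_lX lin_eval_lY; ring.
by rewrite expr2 mulr_suml; apply: eq_bigr => s _; rewrite mulr_sumr.
Qed.

End Values.

Section ComplexValues.
Variables (A : comNzRingType) (iota : {rmorphism C -> A}) (x : 'I_4 -> A).
Let j : {rmorphism R -> A} := iota \o real_complex R.
Definition vB : A := vX j x + iota 'i * vY j x.
Definition vB' : A := vX j x - iota 'i * vY j x.

Lemma lin_eval_real (l : 'I_4 -> R) :
  lin_eval iota x (fun i => (l i)%:C) = lin_eval j x l.
Proof. by []. Qed.

Lemma lin_eval_lB : lin_eval iota x lB = vB.
Proof.
by rewrite /lB lin_evalD lin_evalZ !lin_eval_real lin_eval_lX lin_eval_lY.
Qed.

Lemma lin_eval_lB' : lin_eval iota x lB' = vB'.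
Proof.
by rewrite /lB' lin_evalD lin_evalN lin_evalZ !lin_eval_real lin_eval_lX lin_eval_lY.
Qed.

Lemma vBB' : vB * vB' = vX j x ^+ 2 + vY j x ^+ 2.
Proof.
have ii : iota 'i * iota 'i = -1 by rewrite -rmorphM -expr2 sqrCi rmorphN1.
have -> : vB * vB' = vX j x ^+ 2 - iota 'i * iota 'i * vY j x ^+ 2 by rewrite /vB /vB'; ring.
by rewrite ii mulN1r opprK.
Qed.

Variables (p : {poly {poly C}}) (m : nat).

(** The monomial of c_ab has degree m; four factors equal to the sum of all coordinates raise it to
    the degree of [det_words]. *)
Definition herm_words_term (t : 'I_m.+1 * 'I_m.+1) : nat -> 'I_4 -> C :=
  mono_factor (fun i => (crd 1 i)%:C) lB lB' (fun i => (crd 0 i)%:C) (fun=> 1) m t.1 t.2.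

Definition herm_words (w : {ffun 'I_m.+4 -> 'I_4}) : C :=
  \sum_(t : 'I_m.+1 * 'I_m.+1) p`_(t.1)`_(t.2) * \prod_(k < m.+4) herm_words_term t k (w k).

Lemma herm_wordsE :
  \sum_w iota (herm_words w) * \prod_(k < m.+4) x (w k)
  = (\sum_(a < m.+1) \sum_(b < m.+1) iota p`_a`_b *
       (x (inord 1) ^+ minn a b * vB ^+ (a - b) * vB' ^+ (b - a)
        * x (inord 0) ^+ (m - maxn a b))) * (\sum_i x i) ^+ 4.
Proof.
rewrite sum_words_linear pair_bigA /= mulr_suml; apply: eq_bigr => -[a b] _ /=.
rewrite -mulrA; congr (_ * _).
have [am bm] : (a <= m)%N /\ (b <= m)%N by split; rewrite -ltnS.
rewrite -(prod_mono_factor _ _ _ _ _ 4 am bm); apply: eq_bigr => k _.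
rewrite /herm_words_term /mono_factor /=.
do ?case: ifP => _; rewrite ?lin_eval_lB ?lin_eval_lB' ?lin_eval_real ?lin_eval1 //.
  exact: lin_eval_coord.
exact: lin_eval_coord.
Qed.

(** Conjugation exchanges [lB] and [lB'], which exchanging a and b undoes since p is Hermitian. *)
Lemma herm_words_real w : star p = p -> (complex.Re (herm_words w))%:C = herm_words w.
Proof.
move=> ps; rewrite RRe_real // CrealE; apply/eqP.
rewrite /herm_words rmorph_sum.
pose sw (t : 'I_m.+1 * 'I_m.+1) := (t.2, t.1).
have swK : involutive sw by case.
rewrite (reindex_inj (inv_inj swK)) /=; apply: eq_bigr => -[a b] _ /=.
rewrite rmorphM /= -coef_star ps; congr (_ * _); rewrite rmorph_prod.
apply: eq_bigr => k _ /=; rewrite /herm_words_term /mono_factor /= [minn b a]minnC.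
have lBJ i : (lB i)^* = lB' i by apply: conj_rect.
have lB'J i : (lB' i)^* = lB i by rewrite -lBJ conjCK.
case: (ltnP k (minn a b)) => kab; first by rewrite conj_real.
case: (ltnP k a) => ka; case: (ltnP k b) => kb; rewrite ?lBJ ?lB'J //; first by lia.
by case: ifP => _; rewrite ?conj_real ?rmorph1.
Qed.

(** At a rank one point the determinant is zero, so the penalty disappears for every kappa and p
    remains. *)
Lemma penalized_wordsE kappa z w : star p = p -> x (inord 0) = 1 ->
  x (inord 1) = z * w -> vB = z -> vB' = w ->
  \sum_v iota (complex.Re (herm_words v) + kappa * det_words v)%:C
    * \prod_(k < m.+4) x (v k)
  = (\sum_(a < m.+1) \sum_(b < m.+1) iota p`_a`_b * (z ^+ a * w ^+ b))
    * (\sum_i x i) ^+ 4.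
Proof.
move=> ps x0 x1 zE wE.
rewrite (eq_bigr (fun v => iota (herm_words v) * \prod_(k < m.+4) x (v k)
    + iota kappa%:C * (j (det_words v) * \prod_(k < m.+4) x (v k)))); last first.
  move=> v _.
  have -> : (complex.Re (herm_words v) + kappa * det_words v)%:C
      = herm_words v + kappa%:C * (det_words v)%:C.
    by rewrite rmorphD rmorphM /= herm_words_real.
  by rewrite [iota (_ + _)]rmorphD [iota (_ * _)]rmorphM mulrDl -mulrA.
rewrite big_split -mulr_sumr det_wordsE -vBB' zE wE x0 x1 mul1r subrr expr0n /= mul0r.
rewrite mulr0 addr0 herm_wordsE x0 x1 zE wE; congr (_ * _).
apply: eq_bigr => a _; apply: eq_bigr => b _; congr (_ * _).
have [am bm] : (a <= m)%N /\ (b <= m)%N by split; rewrite -ltnS.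
by have := mono_rank1 1 z w am bm; rewrite !mul1r !expr1n mul1r.
Qed.

End ComplexValues.

Lemma sum_ord4 (V : nmodType) (x : 'I_4 -> V) :
  \sum_i x i = x (inord 0) + x (inord 1) + x (inord 2) + x (inord 3).
Proof.
rewrite !big_ord_recl big_ord0 addr0 !addrA.
by do ?[congr (_ + _)]; congr (x _); apply: val_inj; rewrite /= inordK.
Qed.

(** A zero of the penalty is a rank one matrix. If A > 0 the form equals A^m p(z) at z = B / A; if A
    = 0 then B = 0 and it equals c_mm D^m, the value at infinity. *)
Lemma herm_words_gt0 (p : {poly {poly C}}) m (q : 'I_4 -> R) :
  star p = p -> size p = m.+1 -> (forall z, 0 < hval p z) -> 0 < p`_m`_m ->
  (forall i, 0 <= q i) -> \sum_i q i = 1 ->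
  \sum_w det_words w * \prod_(k < m.+4) q (w k) = 0 ->
  0 < \sum_w complex.Re (herm_words p w) * \prod_(k < m.+4) q (w k).
Proof.
move=> ps szp p_gt0 pmm q0 q1.
have := det_wordsE (@idfun R : {rmorphism R -> R}) q m.
rewrite q1 expr1n mulr1 => -> /eqP; rewrite sqrf_eq0 subr_eq0.
set X := vX _ _; set Y := vY _ _ => /eqP AD.
pose x i := (q i)%:C; pose iota : {rmorphism C -> C} := @idfun C.
have vXE : vX (iota \o real_complex R) x = X%:C.
  by rewrite /vX /X /vX /= -rmorphD -rmorphB -rmorphM.
have vYE : vY (iota \o real_complex R) x = Y%:C.
  by rewrite /vY /Y /vY /= -rmorphD -rmorphB -rmorphM.
have vBJ : (vB iota x)^* = vB' iota x.
  by rewrite /vB /vB' vXE vYE; apply: conj_rect.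
have vBvB' : vB iota x * vB' iota x = x (inord 0) * x (inord 1).
  by rewrite vBB' vXE vYE -!rmorphXn -rmorphD -AD rmorphM.
rewrite -ltcR rmorph0 rmorph_sum.
rewrite (eq_bigr (fun w => iota (herm_words p w) * \prod_(k < m.+4) x (w k))); last first.
  by move=> w _; rewrite rmorphM rmorph_prod /= (herm_words_real _ ps).
rewrite herm_wordsE -[\sum_i x i]rmorph_sum q1 rmorph1 expr1n mulr1.
have [A0 | A0] := eqVneq (q (inord 0)) 0.
  have [X0 Y0] : X = 0 /\ Y = 0.
    move/eqP: AD; rewrite A0 mul0r eq_sym paddr_eq0 ?sqr_ge0 // !sqrf_eq0.
    by case/andP=> /eqP-> /eqP->.
  have B0 : vB iota x = 0 by rewrite /vB vXE vYE X0 Y0 rmorph0 mulr0 addr0.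
  (* With A = X = Y = 0 the last three coordinates all equal D, and their sum is 1. *)
  have D0 : 0 < q (inord 1).
    move: q1 X0 Y0; rewrite sum_ord4 /X /Y /vX /vY /= A0 => q1 X0 Y0.
    by lra.
  rewrite (bigD1 ord_max) //= (bigD1 ord_max) //= B0 minnn maxnn !subnn !expr0.
  (* Any pair other than (m, m) leaves a positive power of A, B or B', all zero. *)
  have zero a b : (a < m.+1)%N -> (b < m.+1)%N -> (a != m) || (b != m) ->
      p`_a`_b * (x (inord 1) ^+ minn a b * 0 ^+ (a - b) * vB' iota x ^+ (b - a)
        * x (inord 0) ^+ (m - maxn a b)) = 0.
    move=> am bm abm; rewrite -vBJ B0 rmorph0 /x A0 rmorph0 !expr0n.
    case: (eqVneq (a - b)%N 0%N) => ab; last by rewrite mulr0 !mul0r mulr0.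
    case: (eqVneq (b - a)%N 0%N) => ba; last by rewrite mulr0 !mul0r mulr0.
    case: (eqVneq (m - maxn a b)%N 0%N) => mab; last by rewrite !mulr0.
    by exfalso; lia.
  rewrite [X in _ + X + _]big1 => [|b bm]; last by apply: zero => //; rewrite bm orbT.
  rewrite [X in _ + X]big1 => [|a am]; last first.
    by rewrite big1 // => b _; apply: zero => //; rewrite am.
  by rewrite !addr0 !mulr1 mulr_gt0 // exprn_gt0 // /x ltcR.
have A_gt0 : 0 < q (inord 0) by rewrite lt0r A0 q0.
have xA : x (inord 0) != 0 by rewrite /x fmorph_eq0.
pose z := vB iota x / x (inord 0).
have zB : vB iota x = x (inord 0) * z by rewrite /z mulrC divfK.
have zB' : vB' iota x = x (inord 0) * z^* by rewrite -vBJ zB rmorphM /= conj_real.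
have zD : x (inord 1) = x (inord 0) * z * z^*.
  by apply: (mulfI xA); rewrite -vBvB' zB zB'; ring.
rewrite zB zB' zD.
rewrite (_ : \sum_a _ = x (inord 0) ^+ m * hval p z).
  by rewrite mulr_gt0 // exprn_gt0 // /x ltcR.
rewrite (@hval_coef _ p m.+1) ?szp // => [|a]; last by rewrite -szp size_coef_herm.
rewrite mulr_sumr; apply: eq_bigr => a _; rewrite mulr_sumr; apply: eq_bigr => b _.
have [am bm] : (a <= m)%N /\ (b <= m)%N by split; rewrite -ltnS.
by rewrite mono_rank1 // mulrCA.
Qed.

(* |1|^2, |z|^2, |1 + z|^2 and |1 - i z|^2 realise the coordinates of the rank
   one matrix with A = 1, D = |z|^2, B = z. *)
Definition tetra (i : 'I_4) : {poly {poly C}} :=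
  hsq (nth 0 [:: 1; 'X; 1 + 'X; 1 - 'i%:P * 'X] i).

Definition cst2 : {rmorphism C -> {poly {poly C}}} :=
  (polyC : {rmorphism {poly C} -> {poly {poly C}}}) \o (polyC : {rmorphism C -> {poly C}}).

Lemma tetra0 : tetra (inord 0) = 1.
Proof. by rewrite /tetra inordK // hsq1. Qed.

Lemma tetra1 : tetra (inord 1) = 'X * 'X%:P.
Proof. by rewrite /tetra inordK // hsqE !map_polyX. Qed.

(** An identity in independent variables z and wbar: B = X + iY with 2X = z + wbar and 2iY = z -
    wbar. *)
Lemma tetra_vB : vB cst2 tetra = 'X /\ vB' cst2 tetra = 'X%:P.
Proof.
pose Z : {poly {poly C}} := 'X; pose W : {poly {poly C}} := 'X%:P.
pose I := cst2 'i; pose h := cst2 (2^-1)%:C.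
have II : I * I = -1 by rewrite -rmorphM -expr2 sqrCi rmorphN1.
have hh : h + h = 1.
  have half2 : 2^-1 + 2^-1 = 1 :> R by lra.
  by rewrite /h -!rmorphD half2 !rmorph1.
have t0 := tetra0; have t1 : tetra (inord 1) = Z * W := tetra1.
have t2 : tetra (inord 2) = (1 + Z) * (1 + W).
  by rewrite /tetra inordK // hsqE !rmorphD !rmorph1 /= !map_polyX.
have t3 : tetra (inord 3) = (1 - I * Z) * (1 + I * W).
  rewrite /tetra inordK // hsqE !rmorphB !rmorphM !rmorph1 /= !map_polyX !map_polyC /=.
  by rewrite -[_%:P%:P in X in _ * X]/(cst2 _) conjCi rmorphN mulNr opprK.
have XE : vX (cst2 \o real_complex R) tetra = h * (Z + W).
  by rewrite /vX t0 t1 t2 -/h; ring.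
have YE : I * vY (cst2 \o real_complex R) tetra = h * (Z - W).
  rewrite /vY t0 t1 t3 -/h.
  (* [ring] treats [I] as a free variable, so the vanishing factor 1 + I * I is isolated. *)
  rewrite (_ : I * _ = h * (I * I * (W - Z) - (1 + I * I) * I * Z * W)); last by ring.
  by rewrite II subrr !mul0r subr0 mulN1r opprB.
rewrite /vB /vB' XE -/I YE -mulrDr -mulrBr addrACA subrr addr0.
by rewrite opprB addrC subrKA !mulrDr -!mulrDl hh !mul1r.
Qed.

(** Summing [sum_words_inj] over all injections gives their number times p S^(4 + n - d) on one side
    and, by [polya_words], nonnegative multiples of products of the [tetra i] on the other. *)
Lemma positive_quotient_normsq (p : {poly {poly C}}) : star p = p ->
  (forall z, 0 < hval p z) -> totdeg p = (2 * degz p)%N ->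
  exists F G, has (fun g => g != 0) G /\ p * normsq G = normsq F.
Proof.
move=> ps p_gt0 ptot.
have p0 : p != 0.
  by apply/eqP=> p0; have := p_gt0 0; rewrite p0 hvalE !horner0 ltxx.
have pmm := diag_coef_gt0 ps p_gt0 ((totdeg_diag ps p0).1 ptot).
set m := degz p in pmm.
have szp : size p = m.+1 by rewrite /m /degz prednK // size_poly_gt0.
have [||k [mu [mu0 form_ge]]] := @penalized_form R 3 m.+3
    (fun w => complex.Re (herm_words p w)) (@det_words m).
- move=> q q0 q1; rewrite (det_wordsE (@idfun R : {rmorphism R -> R})).
  by rewrite q1 expr1n mulr1 sqr_ge0.
- by move=> q q0 q1; apply: herm_words_gt0.
pose d := m.+4.
pose c (w : {ffun 'I_d -> 'I_4}) := complex.Re (herm_words p w) + k * det_words w.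
have [n dn T_ge0] := @polya_words _ R d c mu mu0 form_ge.
pose S := \sum_i tetra i.
have formE : \sum_w cst2 (c w)%:C * \prod_(k < d) tetra (w k) = p * S ^+ 4.
  have [vBE vB'E] := tetra_vB.
  rewrite (@penalized_wordsE _ cst2 tetra p m k _ _ ps tetra0 tetra1 vBE vB'E).
  congr (_ * _).
  by rewrite [RHS](@herm_sum _ p m.+1) ?szp // => a; rewrite -szp size_coef_herm.
have sosT : sos (\sum_(v : {ffun 'I_n -> 'I_4})
    cst2 (\sum_(s : {ffun 'I_d -> 'I_n} | injectiveb s) c [ffun k => v (s k)])%:C
    * \prod_i tetra (v i)).
  apply: sos_sum => v _; apply: sosM; first by apply: sosC; rewrite ler0c.
  by apply: sos_prod => i _; apply: sos_hsq.
have : sos (S ^+ (4 + (n - d)) *+ #|[set s : {ffun 'I_d -> 'I_n} | injectiveb s]%SET|).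
  by apply/sosMn/sosX/sos_sum => i _; apply: sos_hsq.
move=> [G GE]; have [F FE] := sosT; exists F, G; split.
  rewrite has_normsq -GE -mulr_natr mulf_neq0 ?expf_neq0 //.
    (* S is the squared norm of a family containing 1, hence nonzero. *)
    rewrite /S /tetra -(big_map (fun i : 'I_4 =>
      nth 0 [:: 1; 'X; 1 + 'X; 1 - 'i%:P * 'X] i) xpredT (@hsq C)).
    rewrite -/(normsq _) -has_normsq; apply/hasP; exists 1; last exact: oner_neq0.
    by apply/mapP; exists ord0; rewrite ?mem_index_enum.
  (* Injections exist because d <= n. *)
  rewrite -(rmorph_nat cst2) /= !polyC_eq0 pnatr_eq0 card_inj_ffuns !card_ord.
  by rewrite -lt0n ffact_gt0.
rewrite -FE -GE mulrnAr exprD mulrA -formE.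
(* Exchange the sums over words and injections; every injection contributes the same polynomial. *)
under [RHS]eq_bigr do rewrite !rmorph_sum mulr_suml.
rewrite exchange_big /= -sumr_const; apply: eq_big => [s | s].
  by rewrite finset.inE.
rewrite finset.inE => /injectiveP sI.
by rewrite -(@sum_words_inj _ _ _ _ tetra (fun w => cst2 (c w)%:C) s sI).
Qed.

End Quillen.

Theorem theorem4p1 (R : realType) (r : {poly {poly R[i]}})
  (hr : hermsym r) (r_ge0 : forall z : R[i], 0 <= hval r z) :
  [<->
   (exists (h : {poly R[i]}) (Rp : {poly {poly R[i]}}),
      [/\ hermsym Rp, r = hsq h * Rp, (forall z : R[i], 0 < hval Rp z)
        & totdeg Rp = (2 * degz Rp)%N]);
   (exists (h : {poly R[i]}) (Rp : {poly {poly R[i]}}), inQ Rp /\ r = hsq h * Rp);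
   inQ r;
   (exists (h : {poly R[i]}) (Rp : {poly {poly R[i]}}), inQ' Rp /\ r = hsq h * Rp);
   inQ' r].
Proof.
tfae.
- move=> [h [p [/hermsymP ps rE p_gt0 ptot]]]; exists h, p; split=> //.
  by split; [apply/hermsymP | apply: positive_quotient_normsq].
(* The factor |h|^2 is absorbed into the numerator F. *)
- move=> [h [p [[_ [F [G [G0 pGE]]]] rE]]]; split=> //.
  by exists [seq h * f | f <- F], G; rewrite normsq_map -pGE rE mulrA.
(* The denominator [normsq G] serves as s. *)
- move=> [_ [F [G [G0 rGE]]]]; exists 1, r; rewrite hsq1 mul1r; split=> //.
  split=> //; split=> //; exists (normsq G), F; split=> //.
  + exact/hermsymP/star_normsq.
  + exact: hval_normsq_ge0.
  + by rewrite -has_normsq.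
- move=> [h [p [[_ [_ [s [F [hs s_ge0 s0 psE]]]]] rE]]]; split=> //; split=> //.
  by exists s, [seq h * f | f <- F]; split; rewrite ?normsq_map -?psE ?rE ?mulrA.
- move=> [_ [_ [s [F [/hermsymP ss _ s0 rsE]]]]].
  have [|h [p [ps rE p_gt0 ptot]]] := exists_positive_quotient ((hermsymP r).1 hr) r_ge0.
    by exists s, F.
  by exists h, p; split=> //; apply/hermsymP.
Qed.
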